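(* Let $q=c/d$ be a positive rational number ($c,d$ positive integers). Let $W_q(x)=\sum_{n\geq0}|\mathcal{W}_n^q|x^n$ and write $\Gamma(x)=\frac{x(1+W_q(x))}{1-x}=\sum_{n\geq0}a_nx^n$. Let $\Gamma_{c/d}(x)=\sum_{n\geq 0}a_nx^{1+\left\lfloor\frac{(c+d)n}{c}\right\rfloor}$. Then the generating function $P_q(x)$ of prime intervals satisfies $$P_q(x)=\frac{\Gamma_{c/d}(x)}{1-x}.$$
   Context: A $q$-decreasing word of length $n$ is a binary word of length $n$ in which every maximal factor $0^a1^b$ satisfies $a=0$ or $qa>b$; $\mathcal{W}_n^q$ is the set of them, ordered componentwise ($v\leq w$ iff $v_i\leq w_i$ for all $i$). An interval $[v,w]$ ($v\leq w$) in $\mathcal{W}_n^q$ is prime if $w=0^a1^b$ with $a+b=n$ and $qa>b\geq1$. $P_q(x)=\sum_n p_nx^n$ where $p_n$ is the number of prime intervals in $\mathcal{W}_n^q$. *)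

(* Defs.v *)
From HB Require Import structures.
From mathcomp Require Import all_boot all_order all_algebra.
From mathcomp Require Import boolp classical_sets fsbigop.

Set Implicit Arguments.
Unset Strict Implicit.
Unset Printing Implicit Defensive.

Import Order.TTheory GRing.Theory Num.Theory.
Local Open Scope ring_scope.

(* Formal power series over a commutative ring, with the Cauchy product.
   Units are the series with invertible constant coefficient, so f / g is the
   usual quotient as soon as the constant coefficient of g is a unit. *)

Record fps (R : comUnitRingType) := Fps { fps_coef : nat -> R }.

Section FpsRing.
Variable R : comUnitRingType.
Implicit Types f g h : fps R.

HB.instance Definition _ := gen_eqMixin (fps R).
HB.instance Definition _ := gen_choiceMixin (fps R).

Lemma fpsP f g : (forall n, fps_coef f n = fps_coef g n) -> f = g.
Proof.
by case: f g => [f] [g] /= fg; congr Fps; apply: funext.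
Qed.

Definition fps_zero : fps R := Fps (fun=> 0).
Definition fps_opp f : fps R := Fps (fun n => - fps_coef f n).
Definition fps_add f g : fps R := Fps (fun n => fps_coef f n + fps_coef g n).

Fact fps_addA : associative fps_add.
Proof. by move=> f g h; apply: fpsP => n /=; rewrite addrA. Qed.
Fact fps_addC : commutative fps_add.
Proof. by move=> f g; apply: fpsP => n /=; rewrite addrC. Qed.
Fact fps_add0 : left_id fps_zero fps_add.
Proof. by move=> f; apply: fpsP => n /=; rewrite add0r. Qed.
Fact fps_addN : left_inverse fps_zero fps_opp fps_add.
Proof. by move=> f; apply: fpsP => n /=; rewrite addNr. Qed.

HB.instance Definition _ :=
  GRing.isZmodule.Build (fps R) fps_addA fps_addC fps_add0 fps_addN.

Definition fps_one : fps R := Fps (fun n => (n == 0%N)%:R).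
Definition fps_mul f g : fps R :=
  Fps (fun n => \sum_(i < n.+1) fps_coef f i * fps_coef g (n - i)).

Let trunc m f : {poly R} := \poly_(i < m) fps_coef f i.

Let coef_mul_trunc m f g n : (n < m)%N ->
  (trunc m f * trunc m g)`_n = fps_coef (fps_mul f g) n.
Proof.
move=> nm; rewrite coefM /=; apply: eq_bigr => i _.
rewrite !coef_poly (leq_ltn_trans (leq_subr i n) nm).
by rewrite (leq_ltn_trans _ nm) // -ltnS.
Qed.

Fact fps_mulC : commutative fps_mul.
Proof.
move=> f g; apply: fpsP => n.
by rewrite -!(coef_mul_trunc _ _ (ltnSn n)) mulrC.
Qed.

Let coef_mul_trunc3 n f g h :
  (trunc n.+1 f * (trunc n.+1 g * trunc n.+1 h))`_n
  = fps_coef (fps_mul f (fps_mul g h)) n.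
Proof.
rewrite coefM /=; apply: eq_bigr => i _.
by rewrite coef_mul_trunc ?ltnS ?leq_subr // coef_poly ltn_ord.
Qed.

Fact fps_mulA : associative fps_mul.
Proof.
move=> f g h; apply: fpsP => n.
rewrite -coef_mul_trunc3 (fps_mulC (fps_mul f g)) -coef_mul_trunc3.
by congr (_`_n); rewrite mulrA mulrC.
Qed.

Fact fps_mul1 : left_id fps_one fps_mul.
Proof.
move=> f; apply: fpsP => n /=.
rewrite big_ord_recl /= subn0 mul1r big1 ?addr0 // => i _.
by rewrite mul0r.
Qed.

Fact fps_mulD : left_distributive fps_mul fps_add.
Proof.
move=> f g h; apply: fpsP => n /=.
by rewrite -big_split; apply: eq_bigr => i _ /=; rewrite mulrDl.
Qed.

Fact fps_one_neq0 : fps_one != 0.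
Proof.
apply/eqP => /(congr1 (fun f => fps_coef f 0%N)) /= /eqP.
by rewrite oner_eq0.
Qed.

HB.instance Definition _ :=
  GRing.Zmodule_isComNzRing.Build (fps R)
    fps_mulA fps_mulC fps_mul1 fps_mulD fps_one_neq0.

Lemma fps_coef0 n : fps_coef (0 : fps R) n = 0. Proof. by []. Qed.
Lemma fps_coef1 n : fps_coef (1 : fps R) n = (n == 0%N)%:R. Proof. by []. Qed.
Lemma fps_coefD f g n : fps_coef (f + g) n = fps_coef f n + fps_coef g n.
Proof. by []. Qed.
Lemma fps_coefN f n : fps_coef (- f) n = - fps_coef f n.
Proof. by []. Qed.
Lemma fps_coefM f g n :
  fps_coef (f * g) n = \sum_(i < n.+1) fps_coef f i * fps_coef g (n - i).
Proof. by []. Qed.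

Definition fpsC (a : R) : fps R := Fps (fun n => if n == 0%N then a else 0).
Definition fpsX : fps R := Fps (fun n => (n == 1%N)%:R).

Lemma fps_coef_sum (I : Type) (r : seq I) (P : pred I) (F : I -> fps R) n :
  fps_coef (\sum_(i <- r | P i) F i) n = \sum_(i <- r | P i) fps_coef (F i) n.
Proof. by apply: (big_morph (fun f => fps_coef f n)). Qed.

Lemma fps_coefCM a f n : fps_coef (fpsC a * f) n = a * fps_coef f n.
Proof.
rewrite fps_coefM big_ord_recl /= subn0 big1 ?addr0 // => i _.
by rewrite mul0r.
Qed.

Lemma fps_coefXn m n : fps_coef (fpsX ^+ m) n = (n == m)%:R.
Proof.
elim: m n => [|m IH] n; first by rewrite expr0.
rewrite exprS fps_coefM; case: n => [|n].
  by rewrite big_ord1 /= mul0r.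
rewrite big_ord_recl /= mul0r add0r big_ord_recl /= mul1r big1 ?addr0.
  by rewrite IH subSS subn0 eqSS.
by move=> i _; rewrite mul0r.
Qed.

Definition fps_unit : pred (fps R) :=
  fun f => fps_coef f 0 \is a GRing.unit.

(* The inverse is the geometric series f^-1 = u * sum_k (1 - u f)^k, where u is
   the inverse of the constant coefficient of f. The constant coefficient of
   1 - u f is 0, so only the terms k <= n contribute to the n-th coefficient. *)
Definition fps_inv f : fps R :=
  if fps_unit f then
    let u := fpsC (fps_coef f 0)^-1 in
    u * Fps (fun n => \sum_(k < n.+1) fps_coef ((1 - u * f) ^+ k) n)
  else f.

Let coef_exp_lt f k n :
  fps_coef f 0 = 0 -> (n < k)%N -> fps_coef (f ^+ k) n = 0.
Proof.
move=> f0; elim: k n => // k IH n; rewrite ltnS => nk.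
rewrite exprS fps_coefM big1 // => i _.
have [i0|ipos] := posnP i; first by rewrite i0 f0 mul0r.
by rewrite IH ?mulr0 // (leq_trans _ nk) // ltn_subrL ipos (leq_trans ipos) // -ltnS.
Qed.

Fact fps_mulV : {in fps_unit, left_inverse 1 fps_inv *%R}.
Proof.
move=> f fu; rewrite /fps_inv; have -> : fps_unit f = true by [].
set u := fpsC _; set g := 1 - u * f; set S := Fps _.
have g0 : fps_coef g 0 = 0.
  by rewrite fps_coefD fps_coefN fps_coefCM mulVr ?subrr.
rewrite /= -mulrA mulrC -mulrA [f * u]mulrC.
have -> : u * f = 1 - g by rewrite /g opprB addrC subrK.
clearbody g; apply: fpsP => n; pose Sn := \sum_(k < n.+1) g ^+ k.
have -> : fps_coef (S * (1 - g)) n = fps_coef (Sn * (1 - g)) n.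
  rewrite !fps_coefM; apply: eq_bigr => i _; congr (_ * _).
  rewrite fps_coef_sum /= -[in RHS](big_mkord xpredT (fun k => fps_coef (g ^+ k) i)).
  rewrite -(big_mkord xpredT (fun k => fps_coef (g ^+ k) i)).
  have tail0 : \sum_(i.+1 <= k < n.+1) fps_coef (g ^+ k) i = 0.
    by apply: big1_seq => k; rewrite mem_index_iota => /andP[_ /andP[ik _]];
      rewrite coef_exp_lt.
  by rewrite [RHS](big_cat_nat (n := i.+1)) //= tail0 addr0.
have -> : Sn * (1 - g) = 1 - g ^+ n.+1.
  by rewrite -[RHS]opprB subrX1 -mulNr opprB [LHS]mulrC.
by rewrite fps_coefD fps_coefN coef_exp_lt // subr0.
Qed.

Fact fps_unitPl f g : g * f = 1 -> fps_unit f.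
Proof.
move=> /(congr1 (fun h => fps_coef h 0%N)); rewrite fps_coefM big_ord1 => gf.
by apply/unitrPr; exists (fps_coef g 0); rewrite mulrC.
Qed.

Fact fps_inv_out : {in [predC fps_unit], fps_inv =1 id}.
Proof.
move=> f; rewrite inE => /negPf fN; rewrite /fps_inv.
by have -> : fps_unit f = false by exact: fN.
Qed.

HB.instance Definition _ :=
  GRing.ComNzRing_hasMulInverse.Build (fps R) fps_mulV fps_unitPl fps_inv_out.

Lemma fps_unitE f : (f \is a GRing.unit) = (fps_coef f 0 \is a GRing.unit).
Proof. by []. Qed.

Lemma fps_unit_1subX : 1 - fpsX \is a GRing.unit.
Proof. by rewrite fps_unitE fps_coefD fps_coefN /= subr0 unitr1. Qed.

(* The formal sum of a locally finite family: every coefficient is a sum with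
   finite support (and is 0 by convention if the support is infinite). *)
Definition fps_sum (F : nat -> fps R) : fps R :=
  Fps (fun N => \sum_(n \in [set: nat]) fps_coef (F n) N).

Lemma fps_coef_fps_sum (F : nat -> fps R) N m :
  (forall n, (m <= n)%N -> fps_coef (F n) N = 0) ->
  fps_coef (fps_sum F) N = fps_coef (\sum_(n < m) F n) N.
Proof.
move=> F0; rewrite fps_coef_sum /=.
rewrite (fsbig_ord _ m (fun n => fps_coef (F n) N)); symmetry.
apply: fsbig_widen => // n [_ /= /negP nm].
by apply: F0; rewrite leqNgt.
Qed.

End FpsRing.

Arguments fpsX {R}.

(* Binary words: [false] is the letter 0 and [true] is the letter 1. *)

Definition block (a b : nat) : seq bool := nseq a false ++ nseq b true.

(* The occurrence of 0^a 1^b in w between the prefix s1 and the suffix s2 is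
   not properly contained in another occurrence of a factor 0^a' 1^b'. *)
Definition maximal_block (w s1 : seq bool) (a b : nat) (s2 : seq bool) : Prop :=
  w = s1 ++ block a b ++ s2 /\
  forall (t1 : seq bool) (a' b' : nat) (t2 : seq bool),
    w = t1 ++ block a' b' ++ t2 ->
    (size t1 <= size s1)%N -> (size t2 <= size s2)%N ->
    t1 = s1 /\ t2 = s2.

Definition q_decreasing (q : rat) (w : seq bool) : Prop :=
  forall (s1 : seq bool) (a b : nat) (s2 : seq bool),
    maximal_block w s1 a b s2 -> a = 0%N \/ b%:R < q * a%:R.

Definition qwords (q : rat) (n : nat) : {set n.-tuple bool} :=
  [set w : n.-tuple bool | `[< q_decreasing q w >]].

Definition word_le (n : nat) (v w : n.-tuple bool) : bool :=
  [forall i : 'I_n, (tnth v i <= tnth w i)%N].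

Definition is_interval (q : rat) (n : nat) (v w : n.-tuple bool) : bool :=
  [&& v \in qwords q n, w \in qwords q n & word_le v w].

Definition prime_top (q : rat) (n : nat) (w : n.-tuple bool) : Prop :=
  exists a b : nat, [/\ (a + b = n)%N, w = block a b :> seq bool,
                        b%:R < q * a%:R & (1 <= b)%N].

Definition prime_intervals (q : rat) (n : nat) :
    {set n.-tuple bool * n.-tuple bool} :=
  [set I : n.-tuple bool * n.-tuple bool |
     is_interval q I.1 I.2 && `[< prime_top q I.2 >]].

Definition W_series (q : rat) : fps int := Fps (fun n => #|qwords q n|%:Z).

Definition P_series (q : rat) : fps int := Fps (fun n => #|prime_intervals q n|%:Z).

Definition Gamma (q : rat) : fps int := fpsX * (1 + W_series q) / (1 - fpsX).

(* Here [%/] is the quotient in [nat], which is the floor since 0 < c. *)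
Definition Gamma_frac (c d : nat) (q : rat) : fps int :=
  fps_sum (fun n : nat =>
    fpsC (fps_coef (Gamma q) n) * fpsX ^+ (1 + ((c + d) * n) %/ c)%N).

(* Main.v *)
(** A prime top w = 0^a 1^b only bounds the intervals [v, w] by forcing v to
    start with 0^a.  Such a v is either 0^n or 0^(a+i) 1 u; in the second case
    the first block is automatically admissible, because its number of 1s is at
    most b < q a, so v is q-decreasing exactly when u is.  Hence the number of v
    is 1 + sum_(m < b) |W_m|, the coefficient of x^b in Gamma, whatever n is.
    Since b < q (n - b) amounts to 1 + floor((c + d) b / c) <= n, summing over b
    gives the coefficients of Gamma_frac / (1 - x). *)
Require Import Defs.
From mathcomp Require Import all_boot all_order all_algebra.
From mathcomp Require Import boolp zify.
Import Order.TTheory GRing.Theory Num.Theory.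
Local Open Scope ring_scope.

(** * Coefficients of products and quotients of power series *)

Section SeriesCoef.
Variable R : comUnitRingType.
Implicit Types f g : fps R.

Lemma fps_coefXM f n :
  fps_coef (fpsX * f) n = if n is m.+1 then fps_coef f m else 0.
Proof.
rewrite fps_coefM; case: n => [|n]; first by rewrite big_ord1 /= mul0r.
rewrite big_ord_recl /= mul0r add0r big_ord_recl /= mul1r big1 ?addr0.
  by rewrite subSS subn0.
by move=> i _; rewrite mul0r.
Qed.

(** Multiplying the series of partial sums by [1 - fpsX] telescopes back to [f]. *)
Lemma fps_coef_div_1subX f n :
  fps_coef (f / (1 - fpsX)) n = \sum_(i < n.+1) fps_coef f i.
Proof.
pose g : fps R := Fps (fun n => \sum_(i < n.+1) fps_coef f i).
have {1}-> : f = g * (1 - fpsX).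
  apply: fpsP => -[|m]; rewrite mulrBr mulr1 [g * _]mulrC fps_coefD fps_coefN.
    by rewrite fps_coefXM /= big_ord1 subr0.
  by rewrite fps_coefXM /= big_ord_recr /= addrAC subrr add0r.
by rewrite mulrK ?fps_unit_1subX.
Qed.

End SeriesCoef.

(** * Occurrences of blocks and q-decreasing words *)

Lemma size_block a b : size (block a b) = (a + b)%N.
Proof. by rewrite size_cat !size_nseq. Qed.

Lemma nth_block a b i : nth false (block a b) i = (a <= i < a + b)%N.
Proof.
by rewrite nth_cat size_nseq !nth_nseq; case: ltnP; case: ltnP; lia.
Qed.

Lemma nth_occ t1 a b t2 i : (size t1 <= i < size t1 + (a + b))%N ->
  nth false (t1 ++ block a b ++ t2) i = (a + size t1 <= i)%N.
Proof.
move=> h; rewrite nth_cat (nth_cat _ (block a b)) size_block nth_block.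
have -> : (i < size t1)%N = false by lia.
have -> : (i - size t1 < a + b)%N by lia.
lia.
Qed.

Lemma nth_after_occ t1 a b t2 i :
  nth false (t1 ++ block a b ++ t2) (size t1 + (a + b) + i) = nth false t2 i.
Proof.
rewrite nth_cat (nth_cat _ (block a b)) size_block.
have -> : (size t1 + (a + b) + i < size t1)%N = false by lia.
have -> : (size t1 + (a + b) + i - size t1 < a + b)%N = false by lia.
by congr nth; lia.
Qed.

Lemma ones_prefix (s : seq bool) :
  exists k s', s = nseq k true ++ s' /\ head false s' = false.
Proof.
elim: s => [|[] s [k [s' [-> h]]]]; first by exists 0%N, [::].
  by exists k.+1, s'.
by exists 0%N, (false :: nseq k true ++ s').
Qed.

(* Lengthening the run of 1s only strengthens b < q a, so maximality is needed
   on the left only. *)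
Lemma q_decreasingP (q : rat) (w : seq bool) : 0 < q ->
  q_decreasing q w <->
  (forall s1 a b s2, w = s1 ++ block a b ++ s2 -> (0 < a)%N -> last true s1 ->
     b%:R < q * a%:R).
Proof.
move=> q0; split=> [qw s1 a b s2 ew a0 l1|H s1 a b s2 [ew mx]]; last first.
  have [->|a0] := posnP a; [by left | right].
  apply: (H s1 a b s2) => //.
  (* The default [true] settles an empty [s1]; a final 0 of [s1] could be added to the block,
     against maximality. *)
  case/lastP: s1 ew mx => [//|s x]; rewrite last_rcons; case: x => // ew mx.
  have [] := mx s a.+1 b s2.
  - by rewrite ew cat_rcons.
  - by rewrite size_rcons.
  - by [].
  by move/(congr1 size); rewrite size_rcons; lia.
have [k [s2' [es2 h2]]] := ones_prefix s2.
(* Without any 1, more 0s may follow and the block need not be maximal, but then the bound is just 0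
   < q a. *)
have [bk0|bk0] := posnP (b + k).
  by have -> : b = 0%N by [lia]; rewrite mulr_gt0 // ltr0n.
suff mx : maximal_block w s1 a (b + k) s2'.
  have [|] := qw _ _ _ _ mx; first by lia.
  by apply: le_lt_trans; rewrite ler_nat leq_addr.
have ew' : w = s1 ++ block a (b + k) ++ s2'.
  by rewrite ew es2 /block -!catA nseqD -!catA.
split=> // t1 a' b' t2 ew2 le1 le2.
have sz : (size t1 + (a' + b') + size t2 = size s1 + (a + (b + k)) + size s2')%N.
  have := congr1 size ew'.
  by rewrite {1}ew2 !(size_cat, size_block) !addnA.
(* A factor reaching further left would contain the last 1 of [s1] before a 0 of the block; further
   right, a 1 of the block before the 0 that heads [s2']. *)
have e1 : size t1 = size s1.
  apply/eqP; rewrite eqn_leq le1 leqNgt /=; apply/negP => lt1.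
  have n1 : nth false w (size s1).-1.
    rewrite ew' nth_cat ltn_predL (leq_trans _ lt1) //.
    by rewrite nth_last; case: (s1) lt1 l1.
  have n2 : ~~ nth false w (size s1) by rewrite ew' nth_occ; lia.
  by move: n1 n2; rewrite ew2 !nth_occ; lia.
have e2 : size t2 = size s2'.
  apply/eqP; rewrite eqn_leq le2 leqNgt /=; apply/negP => lt2.
  have n1 : nth false w (size s1 + (a + (b + k))).-1.
    by rewrite ew' nth_occ; lia.
  have n2 : ~~ nth false w (size s1 + (a + (b + k))).
    by rewrite ew' -[X in nth _ _ X]addn0 nth_after_occ nth0 h2.
  by move: n1 n2; rewrite ew2 !nth_occ; lia.
have/eqP := etrans (esym ew') ew2; rewrite eqseq_cat //.
case/andP=> /eqP-> ; rewrite eqseq_cat; last by rewrite !size_block; lia.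
by case/andP=> _ /eqP->.
Qed.

(** The 1 before [u] keeps the left-maximality of occurrences that start [u]. *)
Lemma q_decreasing_drop (q : rat) (p u : seq bool) : 0 < q ->
  q_decreasing q (p ++ true :: u) -> q_decreasing q u.
Proof.
move=> q0 /(q_decreasingP _ _ q0) H; apply/(q_decreasingP _ _ q0).
move=> s1 a b s2 eu a0 l1; apply: (H (p ++ true :: s1) a b s2) => //.
  by rewrite eu -catA.
by rewrite last_cat.
Qed.

(** A left-maximal occurrence starts either inside [u], or at the very beginning with at most
    [(size u).+1] letters 1. *)
Lemma q_decreasing_long_zeros (q : rat) (a : nat) (u : seq bool) : 0 < q ->
  (size u).+1%:R < q * a%:R -> q_decreasing q u ->
  q_decreasing q (nseq a false ++ true :: u).
Proof.
move=> q0 ha /(q_decreasingP _ _ q0) H; apply/(q_decreasingP _ _ q0).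
move=> s1 a' b s2 ew a0 l1.
have [->|b0] := posnP b; first by rewrite mulr_gt0 // ltr0n.
have sz := congr1 size ew.
rewrite !(size_block, size_cat) size_nseq /= in sz.
have [lt|le] := ltnP a (size s1).
  have es : s1 = nseq a false ++ true :: drop a.+1 s1.
    rewrite -[LHS](cat_take_drop a.+1) -cat_rcons; congr (_ ++ _).
    have := congr1 (take a.+1) ew; rewrite take_cat size_nseq ltnNge leqnSn /=.
    by rewrite subSnn /= take0 takel_cat // cats1.
  move: ew l1; rewrite {1 2}es -catA last_cat /= => /eqP.
  rewrite eqseq_cat // => /andP[_ /eqP[eu]]; exact: (H _ _ _ _ eu).
have s10 : s1 = [::].
  case/lastP: s1 {sz} ew l1 le => // s x ew; rewrite last_rcons size_rcons => xt le.
  have := congr1 (fun z => nth false z (size s)) ew.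
  rewrite nth_cat size_nseq le nth_nseq le cat_rcons nth_cat ltnn subnn /= xt //.
subst s1; rewrite /= add0n in ew sz.
(* As [b] > 0, both [a] and [a'] are the position of the first 1 of the word. *)
have ea : a' = a.
  have na := congr1 (fun z => nth false z a) ew.
  have na' := congr1 (fun z => nth false z a') ew.
  rewrite nth_cat size_nseq ltnn subnn /= in na.
  rewrite (@nth_occ [::]) /= ?nth_cat ?size_nseq ?nth_nseq in na'; last by lia.
  rewrite addn0 leqnn in na'.
  have [lt|lt|//] := ltngtP a a'; last by rewrite lt in na'.
  by rewrite (@nth_occ [::]) /= in na; lia.
rewrite ea; apply: le_lt_trans ha; rewrite ler_nat; lia.
Qed.

Lemma q_decreasing_zeros (q : rat) n : 0 < q -> q_decreasing q (nseq n false).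
Proof.
move=> q0; apply/(q_decreasingP _ _ q0) => s1 a [|b] s2 ew a0 _.
  by rewrite mulr_gt0 // ltr0n.
have : true \in nseq n false.
  by rewrite ew !mem_cat inE eqxx !orbT.
by rewrite mem_nseq andbF.
Qed.

(** * Counting q-decreasing words with a prescribed prefix of 0s *)

Section CountPrefix.
Variables (q : rat) (q_gt0 : 0 < q).

Definition qwords_zeros (a n : nat) : {set n.-tuple bool} :=
  [set v in qwords q n | prefix (nseq a false) v].

(** [mkseq] gives length [n] without a cast; the result is 0^a 1 u only when [a + m.+1 = n]. *)
Definition zeros_one (a n m : nat) (u : m.-tuple bool) : n.-tuple bool :=
  [tuple of mkseq (nth false (nseq a false ++ true :: u)) n].

Lemma val_zeros_one a n m (u : m.-tuple bool) : (a + m.+1 = n)%N ->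
  zeros_one a n m u = nseq a false ++ true :: u :> seq bool.
Proof.
move=> e; rewrite /=; set s := _ ++ _.
have -> : n = size s by rewrite size_cat size_nseq /= size_tuple.
exact: mkseq_nth.
Qed.

Lemma zeros_one_inj a n m : (a + m.+1 = n)%N -> injective (zeros_one a n m).
Proof.
move=> e u v /(congr1 val); rewrite [LHS]val_zeros_one // [RHS]val_zeros_one //.
by move/eqP; rewrite eqseq_cat // => /andP[_ /eqP[?]]; apply: val_inj.
Qed.

Lemma prefix_nseqS a (v : seq bool) : (a < size v)%N ->
  prefix (nseq a false) v =
  prefix (nseq a.+1 false) v || prefix (nseq a false ++ [:: true]) v.
Proof.
elim: a v => [|a IH] [|[] v] //= lt; rewrite ?prefix0s //; exact: IH.
Qed.

(** Split on the letter after 0^a: if it is 1, the remaining suffix can be any q-decreasing word. *)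
Lemma qwords_zerosS a n m : (a + m.+1 = n)%N -> m.+1%:R < q * a%:R ->
  qwords_zeros a n = qwords_zeros a.+1 n :|: zeros_one a n m @: qwords q m.
Proof.
move=> e lt; apply/setP => v; rewrite !inE prefix_nseqS; last first.
  by rewrite size_tuple; lia.
rewrite andb_orr; congr (_ || _); apply/andP/imsetP.
  move=> [/asboolP qv /prefixP[s es]].
  rewrite -catA /= in es.
  have sz : size s == m.
    by have := congr1 size es; rewrite size_tuple size_cat size_nseq /=; lia.
  exists (Tuple sz); last by apply: val_inj; rewrite [RHS]val_zeros_one.
  by rewrite inE; apply/asboolP; apply: (@q_decreasing_drop _ (nseq a false));
    rewrite -?es.
move=> [u]; rewrite inE => /asboolP qu ->; rewrite val_zeros_one //; split.
  apply/asboolP; apply: q_decreasing_long_zeros => //; by rewrite size_tuple.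
by rewrite -(cat1s true u) catA prefix_prefix.
Qed.

Lemma card_qwords_zeros a n b : (a + b = n)%N -> b%:R < q * a%:R ->
  #|qwords_zeros a n| = (1 + \sum_(m < b) #|qwords q m|)%N.
Proof.
elim: b a => [|b IH] a e lt.
  rewrite big_ord0 addn0 -(cards1 [tuple of nseq n false]); apply: eq_card => v.
  rewrite !inE; apply/andP/eqP => [[_ /prefixP[s es]]|->].
    apply: val_inj => /=.
    have := congr1 size es; rewrite size_tuple size_cat size_nseq es.
    by case: s {es} => [|x s] /=; rewrite ?cats0 -e ?addn0 //; lia.
  split; first by apply/asboolP; exact: q_decreasing_zeros.
  by rewrite -e addn0 prefix_refl.
rewrite (@qwords_zerosS _ _ b) // cardsU disjoint_setI0 ?cards0 ?subn0; last first.
  rewrite disjoint_subset; apply/subsetP => v; rewrite !inE => /andP[_ pv].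
  apply/negP => /imsetP[u _ ev]; move: pv; rewrite ev val_zeros_one //.
  by rewrite -addn1 nseqD prefix_catr // eqxx.
rewrite card_imset; last exact: zeros_one_inj.
rewrite big_ord_recr /= addnA; congr (_ + _)%N; apply: IH; first by lia.
(* The bound survives the induction, since [b] decreases while [a] increases. *)
apply: (@lt_le_trans _ _ (q * a%:R)); last by rewrite ler_pM2l // ler_nat.
by apply: le_lt_trans lt; rewrite ler_nat.
Qed.

End CountPrefix.

(** * Counting prime intervals *)

Section CountIntervals.
Variables (q : rat) (q_gt0 : 0 < q).

Lemma block_q_decreasing a b : b%:R < q * a%:R -> q_decreasing q (block a b).
Proof.
case: b => [|b] lt; first by rewrite /block cats0; exact: q_decreasing_zeros.
apply: (@q_decreasing_long_zeros _ _ (nseq b true)) => //; first by rewrite size_nseq.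
apply/(q_decreasingP _ _ q_gt0) => s1 [|a'] b' s2 ew // _ _.
have : false \in nseq b true by rewrite ew !mem_cat inE eqxx !orbT.
by rewrite mem_nseq andbF.
Qed.

(** A 0 of [w] forces a 0 in [v], and a 1 of [w] leaves the letter free. *)
Lemma word_le_block n a b (v w : n.-tuple bool) : (a + b = n)%N ->
  w = block a b :> seq bool -> word_le v w = prefix (nseq a false) v.
Proof.
move=> e ew.
have sa : size (take a v) = a by rewrite size_takel // size_tuple -e leq_addr.
rewrite prefixE size_nseq; apply/forallP/eqP => [H|H i].
  apply: (@eq_from_nth _ false); first by rewrite sa size_nseq.
  move=> j; rewrite sa => lja; have ljn : (j < n)%N by lia.
  rewrite nth_take // nth_nseq lja.
  have := H (Ordinal ljn); rewrite !(tnth_nth false) /= ew nth_block.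
  by rewrite [(a <= j)%N]leqNgt lja /=; case: nth.
rewrite !(tnth_nth false) ew nth_block.
have [le|lt] := leqP a i; first by rewrite e ltn_ord; case: nth.
by rewrite -(nth_take _ lt) H nth_nseq lt.
Qed.

Definition top_block (n b : nat) : n.-tuple bool :=
  [tuple of mkseq (nth false (block (n - b) b)) n].

Lemma val_top_block n b : (b <= n)%N ->
  top_block n b = block (n - b) b :> seq bool.
Proof. by move=> le; rewrite -[RHS](mkseq_nth false) size_block subnK. Qed.

Lemma count_top_block n b : (b <= n)%N -> count id (top_block n b) = b.
Proof.
by move=> le; rewrite val_top_block // !count_cat !count_nseq mul0n mul1n.
Qed.

Lemma prime_topP n (w : n.-tuple bool) :
  prime_top q w <-> exists2 b : 'I_n.+1,
    (0 < b)%N && (b%:R < q * (n - b)%:R) & w = top_block n b.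
Proof.
split=> [[a [b [e ew lt b0]]]|[b /andP[b0 lt] ->]].
  have lb : (b < n.+1)%N by lia.
  have ea : a = (n - b)%N by lia.
  exists (Ordinal lb); rewrite /= -?ea ?b0 //.
  by apply: val_inj; rewrite [RHS]val_top_block //= -ea.
have lb : (b <= n)%N by rewrite -ltnS.
by exists (n - b)%N, b; split=> //; [rewrite subnK | exact: val_top_block].
Qed.

Lemma card_prime_intervals n : #|prime_intervals q n| =
  (\sum_(b < n.+1 | (0 < b)%N && ((b%:R : rat)  < q * (n - b)%:R)%R)
     (1 + \sum_(m < b) #|qwords q m|))%N.
Proof.
pose D (b : 'I_n.+1) := (0 < b)%N && (b%:R < q * (n - b)%:R).
pose ones (I : n.-tuple bool * n.-tuple bool) : 'I_n.+1 := inord (count id I.2).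
have onesE v (b : 'I_n.+1) : ones (v, top_block n b) = b.
  by rewrite /ones count_top_block ?inord_val // -ltnS.
(* The number of 1s determines a prime top, so it sorts the intervals by their top. *)
rewrite -sum1_card (partition_big ones D) /=; last first.
  move=> [v w]; rewrite inE => /andP[_ /asboolP/prime_topP[b Db /= ->]].
  by rewrite onesE.
apply: eq_bigr => b Db; have lb : (b <= n)%N by rewrite -ltnS.
have /andP[b0 lt] := Db.
rewrite sum1dep_card -(@card_qwords_zeros _ q_gt0 (n - b) n) ?subnK //.
pose f (v : n.-tuple bool) := (v, top_block n b).
have f_inj : injective f by move=> u v [].
rewrite -(card_imset _ f_inj).
apply: eq_card => -[v w]; rewrite !inE /is_interval /=; apply/andP/imsetP.
  move=> [/andP[/and3P[qv _ le] /asboolP/prime_topP[b' _ ew]]].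
  rewrite ew onesE => /eqP eb; exists v; last by rewrite eb.
  rewrite inE qv -(@word_le_block _ _ b v w) ?subnK //.
  by rewrite ew eb val_top_block.
move=> [u]; rewrite inE => /andP[qu pu] [-> ->]; rewrite onesE; split=> //.
rewrite qu (@word_le_block _ (n - b) b) ?subnK ?val_top_block // pu andbT /=.
apply/andP; split; last by apply/asboolP/prime_topP; exists b.
by rewrite inE val_top_block //; apply/asboolP; exact: block_q_decreasing.
Qed.

End CountIntervals.

(** * Comparison with the coefficients of [Gamma] and [Gamma_frac] *)

Lemma fps_coef_Gamma (q : rat) b : fps_coef (Gamma q) b =
  if b is 0 then 0 else (1 + \sum_(m < b) #|qwords q m|)%N%:Z.
Proof.
rewrite /Gamma fps_coef_div_1subX big_ord_recl fps_coefXM add0r.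
case: b => [|b]; first by rewrite big_ord0.
under eq_bigr => i _ do rewrite lift0 fps_coefXM fps_coefD fps_coef1 /=.
rewrite big_split /= big_ord_recl /= big1 // addr0 PoszD; congr (_ + _).
by rewrite (big_morph Posz PoszD (erefl _)).
Qed.

(** The exponent attached to [b] exceeds [b], so no index [b] >= [m] contributes to degree [N]. *)
Lemma fps_coef_Gamma_frac (c d : nat) (q : rat) N m : (0 < c)%N ->
  (N <= m)%N -> fps_coef (Gamma_frac c d q) N =
  \sum_(b < m) fps_coef (Gamma q) b * (N == (1 + ((c + d) * b) %/ c)%N)%:R.
Proof.
move=> c0 le; rewrite /Gamma_frac (@fps_coef_fps_sum _ _ _ m); last first.
  move=> b le'; rewrite fps_coefCM fps_coefXn.
  suff -> : (N == (1 + ((c + d) * b) %/ c)%N) = false by rewrite mulr0.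
  have : (b <= ((c + d) * b) %/ c)%N by rewrite leq_divRL //; nia.
  lia.
by rewrite fps_coef_sum; apply: eq_bigr => b _; rewrite fps_coefCM fps_coefXn.
Qed.

Theorem mainTheorem9 (c d : nat) (q : rat) (hc : (0 < c)%N) (hd : (0 < d)%N)
    (hq : q = c%:R / d%:R) :
  P_series q = Gamma_frac c d q / (1 - fpsX).
Proof.
have q0 : 0 < q by rewrite hq divr_gt0 // ltr0n.
apply: fpsP => n; rewrite fps_coef_div_1subX [LHS]/= card_prime_intervals //.
(* One bound [n.+1] for every [N] lets the two sums be exchanged. *)
under [RHS]eq_bigr => N _ do
  rewrite (@fps_coef_Gamma_frac _ _ _ _ n.+1) ?(ltnW (ltn_ord N)) //.
rewrite exchange_big (big_morph Posz PoszD (erefl _)) big_mkcond.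
apply: eq_bigr => b _; rewrite -big_distrr [in RHS]fps_coef_Gamma.
have lb : (b <= n)%N by rewrite -ltnS.
(* Clearing denominators, both sides say (c + d) b < c n. *)
have -> : (b%:R < q * (n - b)%:R) = (((c + d) * b) %/ c < n)%N.
  rewrite ltn_divLR // hq mulrAC ltr_pdivlMr ?ltr0n // -!natrM ltr_nat.
  nia.
(* At [b] = 0 there is no prime top, and [Gamma] has no constant term. *)
case: (nat_of_ord b) => [|k]; first by rewrite /= mul0r.
set e := (_ %/ c)%N; rewrite /=.
move: (1 + \sum_(m < k.+1) _)%N => A; case: ltnP => lt.
  (* Only the degree 1 + e contributes, and it lies in the range exactly when e < n. *)
  rewrite (bigD1 (Ordinal (lt : (1 + e < n.+1)%N))) //= eqxx big1 ?mulr1 //.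
  by move=> i /eqP ne; case: eqP => // ei; case: ne; apply: val_inj.
rewrite big1 ?mulr0 // => i _; case: eqP => // ei.
by have := ltn_ord i; rewrite ei; lia.
Qed.
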